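(* Let $k, N$ be integers with $2 \le k < N$. Let $M_k$ and $M_{k-1}$ be the largest and second largest elements of a uniformly random $k$-element subset of $\{1,\dots,N\}$. Put $$X_k = M_k\,\frac{k+1}{k} - 1, \qquad X_{k-1} = M_{k-1}\,\frac{k+1}{k-1} - 1,$$ and for $\alpha \in [0,1]$ let $X_\alpha = \alpha X_k + (1-\alpha) X_{k-1}$. Then the unique value of $\alpha\in[0,1]$ minimizing $\mathrm{Var}(X_\alpha)$ is $$\frac{\mathrm{Var}(X_{k-1}) - \mathrm{Cov}(X_k, X_{k-1})}{\mathrm{Var}(X_k) + \mathrm{Var}(X_{k-1}) - 2\,\mathrm{Cov}(X_k, X_{k-1})} = 1.$$
   Context: $k$ tanks are observed, drawn uniformly without replacement from tanks numbered $1,\dots,N$, i.e. every $k$-element subset of $\{1,\dots,N\}$ is equally likely. $X_\alpha$ (parameter $\alpha\in[0,1]$) denotes the weighted statistic and is distinct notation from $X_k$ and $X_{k-1}$, which denote the two unweighted estimators of $N$. *)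

(* Defs.v *)
From HB Require Import structures.
From mathcomp Require Import all_boot all_order all_algebra.
From mathcomp Require Import all_classical all_reals all_analysis.

Set Implicit Arguments.
Unset Strict Implicit.
Unset Printing Implicit Defensive.

Import Order.TTheory GRing.Theory Num.Theory.

Local Open Scope classical_set_scope.
Local Open Scope ring_scope.

(* The tanks are indexed by 'I_N; the number painted on tank i is i.+1, so that
   a set of tanks A : {set 'I_N} stands for the set of numbers i.+1 with
   i \in A, a subset of {1, ..., N}. *)

Definition largest N (A : {set 'I_N}) : nat := (\max_(i in A) i.+1)%N.

Definition second_largest N (A : {set 'I_N}) : nat :=
  (\max_(i in A | (i.+1 < largest A)%N) i.+1)%N.

(* The law of S is the uniform distribution on the k-element sets of tanks. As
   {set 'I_N} is finite, measurability of the events S = A is measurability of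
   S for the discrete sigma-algebra. *)
Definition uniform_ksubset d (T : measurableType d) (R : realType)
    (P : probability T R) N (k : nat) (S : T -> {set 'I_N}) : Prop :=
  forall A : {set 'I_N},
    measurable (S @^-1` [set A]) /\
    P (S @^-1` [set A]) = (if #|A| == k then ('C(N, k)%:R)^-1 else 0)%:E.

Definition estimator_max (R : realType) N (k : nat) (A : {set 'I_N}) : R :=
  (largest A)%:R * ((k%:R + 1) / k%:R) - 1.

Definition estimator_second (R : realType) N (k : nat) (A : {set 'I_N}) : R :=
  (second_largest A)%:R * ((k%:R + 1) / (k%:R - 1)) - 1.

Definition argmin (R : realType) (I : set R) (f : R -> \bar R) : set R :=
  [set a | I a /\ forall b, I b -> (f a <= f b)%E].

(* Main.v *)
Require Import Defs.
From HB Require Import structures.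
From mathcomp Require Import all_boot all_order all_algebra.
From mathcomp Require Import all_classical all_reals all_analysis.
From mathcomp Require Import ring lra.

Set Implicit Arguments.
Unset Strict Implicit.
Unset Printing Implicit Defensive.

Import Order.TTheory GRing.Theory Num.Theory.

Local Open Scope classical_set_scope.
Local Open Scope ring_scope.

(** Mixing in X_{k-1} only adds noise to X_k. Indeed, given that the largest
    number is m, the k - 1 others form a uniform (k-1)-subset of
    {1, ..., m-1}, so their maximum has mean m (k-1)/k. The two normalisations
    are tuned so that this reads E[X_{k-1} | M_k] = X_k. The gap
    U = X_{k-1} - X_k therefore averages to 0 against every function of M_k
    ([gap_centered]); in particular E[U] = 0 and E[X_k U] = 0.

    The estimators in play all have the form X_k + s U, with s = 0 for X_k,
    s = 1 for X_{k-1} and s = 1 - alpha for X_alpha. As U is centered and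
    uncorrelated with X_k,
      Cov(X_k + s U, X_k + t U) = Var(X_k) + s t E[U^2]
    ([ucov_add_uncorrelated]). Hence Var(X_alpha) = Var(X_k) + (1-alpha)^2 E[U^2],
    while the ratio is E[U^2] / E[U^2]. It remains to see that E[U^2] > 0: as
    k < N, the set {1, ..., k-1, k+1} may be drawn and its gap is not 0
    ([gap_neq0]).

    Conditioning on M_k is done by counting. A set is determined by its largest
    element and the set of the others ([peel_max_sum]); two such steps turn a
    sum over k-subsets of a function of the two largest elements into a double
    sum weighted by binomial coefficients ([sum_top_two]), which two summation
    formulas evaluate. *)

(** * Sets of tanks sorted by their largest elements *)

Definition below N (m : nat) : {set 'I_N} := [set j : 'I_N | (j < m)%N]%SET.

Lemma card_below N m : (m <= N)%N -> #|below N m| = m.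
Proof.
move=> mN; rewrite -sum1_card.
under eq_bigl do rewrite inE.
by rewrite -(big_ord_widen N (fun=> 1%N) mN) sum1_card card_ord.
Qed.

Section PeelMaximum.
Variable N : nat.
Implicit Types (i : 'I_N) (A B : {set 'I_N}).

Lemma below_notin i B : B \subset below N i -> i \notin B.
Proof.
by move=> /fintype.subsetP Bi; apply/negP => /Bi; rewrite inE ltnn.
Qed.

Lemma largest_below m B : B \subset below N m -> (largest B <= m)%N.
Proof. by move=> /fintype.subsetP Bm; apply/bigmax_leqP => j /Bm; rewrite inE. Qed.

Lemma largestU1 i B : B \subset below N i -> largest (i |: B)%SET = i.+1.
Proof.
move=> Bi; rewrite /largest big_setU1 ?below_notin//=.
by apply/maxn_idPl/leqW/largest_below.
Qed.

Lemma second_largestU1 i B :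
  B \subset below N i -> second_largest (i |: B)%SET = largest B.
Proof.
move=> Bi; rewrite /second_largest largestU1//; apply: eq_bigl => j.
rewrite !inE; have [->|ji] /= := eqVneq j i.
  by rewrite ltnn; apply/esym/negbTE/below_notin.
by apply: andb_idr => /(fintype.subsetP Bi); rewrite inE.
Qed.

Lemma peel_maxP A : (0 < #|A|)%N ->
  {i | i \in A & (A :\ i)%SET \subset below N i}.
Proof.
move=> A0; have [i0 i0A] : {i0 | i0 \in A} by apply/sigW/card_gt0P.
case: (@arg_maxnP _ i0 (mem A) val i0A) => i iA imax.
exists i => //; apply/fintype.subsetP => j; rewrite !inE => /andP[ji jA].
by rewrite ltn_neqAle ji; exact: imax.
Qed.

Lemma peel_max_unique i B j :
  B \subset below N i -> j \in (i |: B)%SET ->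
  ((i |: B) :\ j)%SET \subset below N j -> j = i.
Proof.
move=> Bi; rewrite !inE => /orP[/eqP//|jB] /fintype.subsetP Bj.
have ji : (j < i)%N by have := fintype.subsetP Bi _ jB; rewrite inE.
have : i \in below N j.
  by apply: Bj; rewrite !inE eqxx andbT; apply: contraTneq ji => ->; rewrite ltnn.
by rewrite inE ltnNge (ltnW ji).
Qed.

(** The map (i, B) |-> i |: B is a bijection from the pairs with B strictly below
    i onto the nonempty sets. *)
Lemma peel_max_sum (V : nmodType) (F : {set 'I_N} -> V) m p :
  \sum_(A : {set 'I_N} | (A \subset below N m) && (#|A| == p.+1)) F A =
  \sum_(i < N | (i < m)%N)
    \sum_(B : {set 'I_N} | (B \subset below N i) && (#|B| == p)) F (i |: B)%SET.
Proof.
rewrite pair_big_dep/=.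
(* The inverse bijection is partial, being undefined on the empty set. *)
pose top A := [pick i in A | (A :\ i)%SET \subset below N i].
rewrite (reindex_omap (fun q : 'I_N * {set 'I_N} => (q.1 |: q.2)%SET)
   (fun A => omap (fun i => (i, (A :\ i)%SET)) (top A))); last first.
  move=> A /andP[_ /eqP cA]; rewrite /top; case: pickP => [i /andP[iA _]|noi].
    by rewrite /= finset.setD1K.
  have [|i iA Ai] := @peel_maxP A; first by rewrite cA.
  by have := noi i; rewrite /= iA Ai.
apply: eq_bigl => -[i B] /=; apply/idP/idP.
  move=> /andP[/andP[iBm ciB]]; rewrite /top; case: pickP => //= j.
  move=> /andP[_ jB] /eqP[ji BE]; subst j.
  have iB : i \notin B by rewrite -BE !inE eqxx.
  move: jB ciB; rewrite BE cardsU1 iB add1n eqSS => -> ->; rewrite !andbT.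
  by have := fintype.subsetP iBm i; rewrite !inE eqxx; apply.
move=> /andP[im /andP[Bi /eqP cB]].
rewrite cardsU1 below_notin// cB eqxx andbT.
apply/andP; split.
  apply/fintype.subsetP => j; rewrite !inE => /orP[/eqP->//|/(fintype.subsetP Bi)].
  by rewrite inE => /ltn_trans; apply.
have iBK : ((i |: B) :\ i)%SET = B by rewrite setU1K// below_notin.
rewrite /top; case: pickP => [j /andP[jiB jB]|/(_ i)]/=.
  by rewrite (peel_max_unique Bi jiB jB) iBK.
by rewrite iBK Bi !inE eqxx.
Qed.

(** Below the second largest element, whose index is j, the remaining p elements
    are arbitrary; this leaves 'C(j, p) sets for each pair of top elements. *)
Lemma sum_top_two (V : nmodType) (F : nat -> nat -> V) p :
  \sum_(A : {set 'I_N} | #|A| == p.+2) F (largest A) (second_largest A) =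
  \sum_(i < N) \sum_(j < i) F i.+1 j.+1 *+ 'C(j, p).
Proof.
transitivity (\sum_(A : {set 'I_N} | (A \subset below N N) && (#|A| == p.+2))
    F (largest A) (second_largest A)).
  apply: eq_bigl => A; suff -> : A \subset below N N by [].
  by apply/fintype.subsetP => j _; rewrite inE.
rewrite peel_max_sum; apply: eq_big => [i|i _]; first by rewrite ltn_ord.
transitivity (\sum_(B : {set 'I_N} | (B \subset below N i) && (#|B| == p.+1))
    F i.+1 (largest B)).
  by apply: eq_bigr => B /andP[Bi _]; rewrite largestU1// second_largestU1.
rewrite peel_max_sum.
rewrite (big_ord_widen N (fun j => F i.+1 j.+1 *+ 'C(j, p)) (ltnW (ltn_ord i))).
apply: eq_bigr => j _.
rewrite -[X in 'C(X, _)](card_below (ltnW (ltn_ord j))) -cards_draws -sumr_const.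
apply: eq_big => [B|B /andP[Bj _]]; first by rewrite inE.
by rewrite largestU1.
Qed.

End PeelMaximum.

(** * The second largest number given the largest *)

Lemma hockey_stick n p : (\sum_(j < n) 'C(j, p) = 'C(n, p.+1))%N.
Proof.
by elim: n => [|n IH]; rewrite ?big_ord0// big_ord_recr/= IH binS.
Qed.

(** Dividing by the number 'C(n, p.+1) of (p.+1)-subsets of {1, ..., n}, when it
    is positive, gives the mean (p+1)(n+1)/(p+2) of the maximum of such a
    subset. *)
Lemma sum_succ_mul_bin n p :
  (p.+2 * (\sum_(j < n) j.+1 * 'C(j, p)) = p.+1 * n.+1 * 'C(n, p.+1))%N.
Proof.
under eq_bigr do rewrite (mul_bin_diag _.+1).
rewrite -big_distrr/=.
have -> : (\sum_(j < n) 'C(j.+1, p.+1) = 'C(n.+1, p.+2))%N.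
  by rewrite -hockey_stick [RHS]big_ord_recl/= bin0n add0n.
by rewrite mulnCA -(mul_bin_diag n.+1) mulnA.
Qed.

(** With k = p.+2, this is E[M_{k-1} | M_k] = M_k (k-1)/k, the arbitrary
    weight g playing the role of the conditioning: the sum over the sets with
    any given largest number already vanishes. *)
Lemma sum_second_centered (R : comPzRingType) N p (g : nat -> R) :
  \sum_(A : {set 'I_N} | #|A| == p.+2) g (largest A) *
    (p.+2%:R * (second_largest A)%:R - p.+1%:R * (largest A)%:R) = 0.
Proof.
rewrite (sum_top_two N (fun l s => g l * (p.+2%:R * s%:R - p.+1%:R * l%:R))).
apply: big1 => i _; under eq_bigr do rewrite -mulrnAr.
rewrite -big_distrr/= (_ : \sum_(j < i) _ = 0) ?mulr0//.
transitivity (\sum_(j < i) ((p.+2 * (j.+1 * 'C(j, p)))%:R -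
    (p.+1 * i.+1 * 'C(j, p))%:R : R)).
  by apply: eq_bigr => j _; rewrite mulrnBl -!natrM -!mulrnA !mulnA.
rewrite sumrB -!natr_sum -!big_distrr/= hockey_stick sum_succ_mul_bin.
exact: subrr.
Qed.

(** * Means and covariances under the uniform law on k-subsets *)

Section UniformMean.
Variables (R : realType) (N k : nat).
Implicit Types f g x y u : {set 'I_N} -> R.

Definition umean f : R :=
  'C(N, k)%:R^-1 * \sum_(A : {set 'I_N} | #|A| == k) f A.

Definition ucov f g : R :=
  umean (fun A => (f A - umean f) * (g A - umean g)).

Lemma umeanD f g : umean (fun A => f A + g A) = umean f + umean g.
Proof. by rewrite /umean big_split mulrDr. Qed.

Lemma umeanZ a f : umean (fun A => a * f A) = a * umean f.
Proof. by rewrite /umean -big_distrr/= mulrCA. Qed.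

(** All terms that are linear in u drop out, so that u contributes to the
    covariance through its second moment only. *)
Lemma ucov_add_uncorrelated x u s t :
  umean u = 0 -> umean (fun A => x A * u A) = 0 ->
  ucov (fun A => x A + s * u A) (fun A => x A + t * u A) =
  ucov x x + s * t * umean (fun A => u A ^+ 2).
Proof.
move=> u0 xu0; rewrite /ucov !umeanD !umeanZ u0 !mulr0 !addr0.
set mu := umean x.
transitivity (umean (fun A => (x A - mu) * (x A - mu) +
    ((s + t) * (x A * u A) + (- ((s + t) * mu) * u A + s * t * u A ^+ 2)))).
  by congr umean; apply/funext => A; ring.
by rewrite !umeanD !umeanZ u0 xu0 !mulr0 !add0r.
Qed.

Lemma umean_sqr_gt0 u (A0 : {set 'I_N}) : (k <= N)%N -> #|A0| = k -> u A0 != 0 ->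
  0 < umean (fun A => u A ^+ 2).
Proof.
move=> kN cA0 uA0; rewrite /umean mulr_gt0// ?invr_gt0 ?ltr0n ?bin_gt0//.
rewrite (bigD1 A0) ?cA0//= ltr_wpDr ?exprn_even_gt0//.
by apply: sumr_ge0 => A _; exact: sqr_ge0.
Qed.

End UniformMean.

(** * Reduction of expectations to finite sums *)

Section UniformSubset.
Context d (T : measurableType d) (R : realType) (P : probability T R).
Variables (N k : nat) (S : T -> {set 'I_N}).
Hypothesis hS : uniform_ksubset P k S.

(** A function of S is a linear combination of the indicators of the events
    S = A, and these are integrable because they are measurable. *)
Lemma expectation_umean (f : {set 'I_N} -> R) :
  'E_P[fun w => f (S w)]%E = (umean k f)%:E.
Proof.
rewrite unlock.
have iA (A : {set 'I_N}) :
    P.-integrable setT (fun w => (\1_(S @^-1` [set A]) w)%:E).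
  by apply: integrable_indic; have [] := hS A.
transitivity (\int[P]_w (\sum_(A : {set 'I_N})
    ((f A)%:E * (\1_(S @^-1` [set A]) w)%:E))%E)%E.
  apply: eq_integral => w _; rewrite (bigD1 (S w))//= big1 ?adde0.
    by rewrite indicE mem_set// mule1.
  move=> A ASw; rewrite indicE memNset ?mule0// => /= SwA.
  by rewrite SwA eqxx in ASw.
rewrite integral_sum//; last by move=> A; exact: integrableZl.
rewrite /umean mulr_sumr -sumEFin [RHS]big_mkcond/=.
apply: eq_bigr => A _; have [mA PA] := hS A.
rewrite integralZl// integral_indic// setIT [X in (_ * X)%E]PA -EFinM.
by case: ifP => _; rewrite ?mulr0// mulrC.
Qed.

Lemma covariance_ucov (f g : {set 'I_N} -> R) :
  covariance P (fun w => f (S w)) (fun w => g (S w)) = (ucov k f g)%:E.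
Proof.
rewrite unlock !expectation_umean.
exact: (expectation_umean (fun A => (f A - umean k f) * (g A - umean k g))).
Qed.

End UniformSubset.

(** * The gap between the two estimators *)

Section EstimatorDifference.
Variables (R : realType) (N k : nat).
Hypotheses (k_ge2 : (2 <= k)%N) (k_ltN : (k < N)%N).

Definition gap (A : {set 'I_N}) : R := estimator_second R k A - estimator_max R k A.

Lemma gapE A : gap A = (k%:R + 1) / (k%:R * k.-1%:R) *
  (k%:R * (second_largest A)%:R - k.-1%:R * (largest A)%:R).
Proof.
rewrite /gap /estimator_second /estimator_max.
have -> : k%:R - 1 = k.-1%:R :> R by rewrite -subn1 natrB// ltnW.
have k0 : k%:R != 0 :> R by rewrite pnatr_eq0 -lt0n ltnW.
have k1 : k.-1%:R != 0 :> R by rewrite pnatr_eq0 -lt0n -ltnS prednK// ltnW.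
by field; rewrite k0 k1.
Qed.

Lemma gap_centered (g : nat -> R) :
  umean k (fun A : {set 'I_N} => g (largest A) * gap A) = 0.
Proof.
rewrite (_ : (fun A => _) = fun A => (k%:R + 1) / (k%:R * k.-1%:R) *
  (g (largest A) * (k%:R * (second_largest A)%:R - k.-1%:R * (largest A)%:R))).
  rewrite umeanZ /umean; case: k k_ge2 => [|[|p]]// _.
  by rewrite sum_second_centered !mulr0.
by apply/funext => A; rewrite gapE mulrCA.
Qed.

(** In {1, ..., k-1, k+1} the two largest numbers are k-1 and k+1, and
    k (k-1) < (k-1) (k+1). The set {1, ..., k}, the only one when N = k, has
    gap 0. *)
Lemma gap_neq0 : {A : {set 'I_N} | #|A| = k & gap A != 0}.
Proof.
(* The index k carries the number k+1; B carries the numbers 1, ..., k-1. *)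
pose i := Ordinal k_ltN; pose B := below N k.-1.
have Bi : B \subset below N i.
  apply/fintype.subsetP => j; rewrite !inE => /leq_trans; apply.
  exact: leq_pred.
have k_gt0 : (0 < k)%N by exact: ltnW.
exists (i |: B)%SET.
  rewrite cardsU1 below_notin// card_below ?add1n ?prednK//.
  by rewrite (leq_trans (leq_pred _)) ?(ltnW k_ltN).
rewrite gapE largestU1// second_largestU1// mulf_neq0//.
  rewrite mulf_eq0 negb_or natr1 pnatr_eq0/= invr_eq0 mulf_neq0//.
    by rewrite pnatr_eq0 -lt0n.
  by rewrite pnatr_eq0 -lt0n -ltnS prednK.
rewrite -!natrM subr_eq0 eqr_nat neq_ltn /=.
apply/orP; left; apply: (@leq_ltn_trans (k * k.-1)).
  by rewrite leq_mul2l largest_below ?orbT.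
by rewrite mulnC ltn_pmul2l// -ltnS prednK.
Qed.

End EstimatorDifference.

(** * The variance of the weighted statistic *)

Lemma covariance_estimators d (T : measurableType d) (R : realType)
    (P : probability T R) N k (S : T -> {set 'I_N}) (s t : R) :
  (2 <= k)%N -> uniform_ksubset P k S ->
  covariance P
    (fun w => estimator_max R k (S w) + s * gap R k (S w))
    (fun w => estimator_max R k (S w) + t * gap R k (S w)) =
  (ucov k (@estimator_max R N k) (@estimator_max R N k) +
   s * t * umean k (fun A : {set 'I_N} => gap R k A ^+ 2))%:E.
Proof.
move=> k_ge2 hS.
rewrite (covariance_ucov hS (fun A => estimator_max R k A + s * gap R k A)
  (fun A => estimator_max R k A + t * gap R k A)).
congr EFin; apply: ucov_add_uncorrelated.
  rewrite -[RHS](@gap_centered R N k k_ge2 (fun=> 1)).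
  by congr umean; apply/funext => A; rewrite mul1r.
exact: (@gap_centered R N k k_ge2 (fun m => m%:R * ((k%:R + 1) / k%:R) - 1)).
Qed.

Theorem mainTheorem1 (d : measure_display) (T : measurableType d)
    (R : realType) (P : probability T R) (k N : nat)
    (S : T -> {set 'I_N})
    (hk : (2 <= k)%N) (hkN : (k < N)%N)
    (hS : uniform_ksubset P k S) :
  let Xk : T -> R := fun w => estimator_max R k (S w) in
  let Xk1 : T -> R := fun w => estimator_second R k (S w) in
  let X (alpha : R) : T -> R :=
    fun w => alpha * Xk w + (1 - alpha) * Xk1 w in
  let vk : R := fine 'V_P[Xk] in
  let vk1 : R := fine 'V_P[Xk1] in
  let c : R := fine (covariance P Xk Xk1) in
  let ratio : R := (vk1 - c) / (vk + vk1 - 2 * c) in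
  argmin `[0, 1] (fun alpha => 'V_P[X alpha]) = [set ratio] /\ ratio = 1.
Proof.
move=> Xk Xk1 X vk vk1 c ratio.
pose U w := gap R k (S w).
pose v := ucov k (@estimator_max R N k) (@estimator_max R N k).
pose q : R := umean k (fun A => @gap R N k A ^+ 2).
have q_gt0 : 0 < q.
  have [A cA A0] := @gap_neq0 R N k hk hkN.
  exact: umean_sqr_gt0 (ltnW hkN) cA A0.
have covE s t : covariance P (fun w => Xk w + s * U w)
    (fun w => Xk w + t * U w) = (v + s * t * q)%:E.
  exact: covariance_estimators.
have XkE : Xk = fun w => Xk w + 0 * U w.
  by apply/funext => w; rewrite mul0r addr0.
have Xk1E : Xk1 = fun w => Xk w + 1 * U w.
  by apply/funext => w; rewrite mul1r /U /gap addrC subrK.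
have XE a : X a = fun w => Xk w + (1 - a) * U w.
  by apply/funext => w; rewrite /X Xk1E; ring.
have vkE : vk = v.
  by rewrite /vk /variance XkE covE mul0r mul0r addr0.
have vk1E : vk1 = v + q.
  by rewrite /vk1 /variance Xk1E covE !mul1r.
have cE : c = v.
  by rewrite /c Xk1E {1}XkE covE !mul0r addr0.
have varE a : 'V_P[X a] = (v + (1 - a) ^+ 2 * q)%:E.
  by rewrite /variance XE covE expr2.
have ratio1 : ratio = 1.
  by rewrite /ratio vkE vk1E cE; field; rewrite gt_eqF//; lra.
split=> //; rewrite ratio1; apply/seteqP; split=> [a [_ amin]|_ ->] /=.
  have := amin 1; rewrite /= in_itv/= ler01 lexx => /(_ isT).
  rewrite !varE lee_fin subrr expr0n/= mul0r addr0 gerDl pmulr_lle0// => a_le0.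
  apply/eqP; rewrite eq_sym -subr_eq0 -sqrf_eq0 eq_le a_le0; exact: sqr_ge0.
split; first by rewrite /= in_itv/= ler01 lexx.
move=> b _; rewrite !varE lee_fin subrr expr0n/= mul0r addr0 lerDl.
by rewrite mulr_ge0 ?sqr_ge0// ltW.
Qed.
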